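(* Assume that the (absolute) root system of $G$ is irreducible, that $\mu\in X_*(T)_+$ is minuscule, and that $b\in\Omega$ with $[b]\in B(G,\mu)$. There exists a (well-defined) map $$\flat\colon(\Omega\cap\mathbb J_b)\backslash\mathcal A_{\mu,b}\to\{\nu\in W_0\mu\mid\nu^\diamond\le\nu_b\},\qquad(\Omega\cap\mathbb J_b)\lambda\mapsto\lambda^\flat.$$
   Context: Let $F$ be a non-archimedean local field with finite residue field, $L$ the completion of its maximal unramified extension, $\sigma$ the Frobenius of $L/F$, $\mathcal O\subset L$ and $\mathcal O_F\subset F$ the valuation rings, $\varpi$ a uniformizer of $F$. Let $G$ be a connected reductive group over $\mathcal O_F$, $T\subset B\subset G$ a maximal torus and a Borel subgroup over $\mathcal O_F$, $X^*(T),X_*(T)$ the (co)characters with pairing $\langle\,,\rangle$, $\Phi=\Phi_+\sqcup\Phi_-$ the roots (positive with respect to $B$), $W_0$ the finite Weyl group; $\sigma$ acts on the based root datum. $\tilde W=N_G(T)(L)/T(\mathcal O)=X_*(T)\rtimes W_0$ is the Iwahori-Weyl group; $\varpi^\lambda u$ acts on $X_*(T)_{\mathbb R}$ by $v\mapsto uv+\lambda$. $\Pi\subset\Phi$ is the set of negatives of simple roots together with the highest positive root. An affine root $(\alpha,k)$ is the function $v\mapsto-\langle\alpha,v\rangle+k$; $\tilde\alpha=(\alpha,0)$ if $\alpha\in\Phi_-$ and $(\alpha,1)$ if $\alpha\in\Phi_+$. $\Omega\subset\tilde W$ is the subgroup of length $0$ elements (those permuting $\{\tilde\alpha\mid\alpha\in\Pi\}$),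 and $\Omega\cap\mathbb J_b=\{w\in\Omega\mid b\sigma(w)b^{-1}=w\}$, acting on $X_*(T)$ by affine transformations. For $\nu,\nu'\in X_*(T)_{\mathbb Q}$, $\nu\le\nu'$ means that $\nu'-\nu$ is a non-negative rational combination of positive coroots; $\nu^\diamond$ is the $\sigma$-average of $\nu$. $\kappa$ is the Kottwitz map, $\nu_b$ the (dominant) Newton point of $b$, and $B(G,\mu)=\{[b]\mid\kappa(b)=\kappa(\varpi^\mu),\ \nu_b\le\mu^\diamond\}$. For $\lambda\in X_*(T)$ and $\alpha\in\Phi$ put $\lambda_\alpha=\langle\alpha,\lambda\rangle$ if $\alpha\in\Phi_-$ and $\lambda_\alpha=\langle\alpha,\lambda\rangle-1$ if $\alpha\in\Phi_+$. $\lambda^\natural=b\sigma(\lambda)-\lambda$ and $\mathcal A_{\mu,b}=\{\lambda\in X_*(T)\mid\lambda^\natural\in W_0\mu\}$ (equivalently, the set of $\lambda$ for which the piece $X_\mu(b)\cap I\varpi^\lambda K/K$ of the affine Deligne-Lusztig variety is non-empty). $\epsilon_\lambda\in W_0$ is the unique element with $\{\alpha\in\Phi\mid\lambda_\alpha\ge0\}=\epsilon_\lambda\Phi_+$, and $\lambda^\flat=\epsilon_\lambda^{-1}(\lambda^\natural)$. *)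

(* Defs.v *)
From HB Require Import structures.
From mathcomp Require Import all_boot all_order all_algebra.
From mathcomp Require Import finmap.
From mathcomp Require Import boolp classical_sets functions.

Set Implicit Arguments.
Unset Strict Implicit.
Unset Printing Implicit Defensive.

Import Order.TTheory GRing.Theory Num.Theory.
Local Open Scope ring_scope.
Local Open Scope classical_set_scope.

(* A pair (T, B) in a connected reductive group G over O_F enters only        *)
(* through its based root datum and the action of Frobenius on it.  G is      *)
(* split by a finite unramified extension of F, so Frobenius acts with finite *)
(* order; conversely, every based root datum with an automorphism of finite   *)
(* order comes from such a (G, T, B).                                         *)
(*                                                                            *)
(* Choosing a basis of X_*(T), and the dual basis of X^*(T), cocharacters are *)
(* columns 'cV[int]_n, characters are rows 'rV[int]_n, and the perfect        *)
(* pairing is the matrix product.  A matrix g of GL_n(Z) acts on cocharacters *)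
(* by g *m v and on characters contragrediently, by a *m invmx g.             *)

Notation cochar n := 'cV[int]_n.
Notation char n := 'rV[int]_n.

Definition pairing n (a : char n) (v : cochar n) : int := (a *m v) 0 0.

Definition char_act n (g : 'M[int]_n) (a : char n) : char n := a *m invmx g.

(* v |-> v - <a, v> c, as a matrix *)
Definition refl_mx n (a : char n) (c : cochar n) : 'M[int]_n := 1%:M - c *m a.

Definition nonneg_comb n (S : {fset char n}) (a : char n) : Prop :=
  exists m : char n -> nat, a = \sum_(d <- S) d *+ m d.

Record based_root_datum (n : nat) := BasedRootDatum {
  Phi : {fset char n};
  coroot : char n -> cochar n;  (* meaningful on Phi only *)
  Delta : {fset char n};
  sigma : 'M[int]_n;
  (* a positive multiple of the order of sigma: the degree of some            *)
  (* unramified extension of F splitting G                                    *)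
  sdeg : nat;
  coroot_inj : {in Phi &, injective coroot};
  pairing_coroot : forall a, a \in Phi -> pairing a (coroot a) = 2;
  refl_root : forall a b, a \in Phi -> b \in Phi ->
    b - a *~ pairing b (coroot a) \in Phi;
  refl_coroot : forall a b, a \in Phi -> b \in Phi ->
    exists2 c, c \in Phi & coroot c = coroot b - coroot a *~ pairing a (coroot b);
  reduced : forall a, a \in Phi -> a *+ 2 \notin Phi;
  Delta_sub : {subset Delta <= Phi};
  Delta_free : forall m : char n -> int,
    \sum_(d <- Delta) d *~ m d = 0 -> forall d, d \in Delta -> m d = 0;
  Delta_base : forall a, a \in Phi ->
    nonneg_comb Delta a \/ nonneg_comb Delta (- a);
  sdeg_gt0 : (0 < sdeg)%N;
  sigma_sdeg : sigma ^+ sdeg = 1%:M;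
  sigma_Phi : forall a, a \in Phi -> char_act sigma a \in Phi;
  sigma_coroot : forall a, a \in Phi ->
    coroot (char_act sigma a) = sigma *m coroot a;
  sigma_Delta : forall a, a \in Delta -> char_act sigma a \in Delta
}.

(* The Iwahori-Weyl group X_*(T) x| W_0: IW t u stands for varpi^t u.  The    *)
(* condition that the linear part lies in W_0 is imposed where elements are   *)
(* quantified (see Omega).                                                    *)
Record iw (n : nat) := IW { trans : cochar n; lin : 'M[int]_n }.

Definition iw_act n (w : iw n) (v : cochar n) : cochar n := lin w *m v + trans w.

Definition iw_mul n (w w' : iw n) : iw n :=
  IW (trans w + lin w *m trans w') (lin w *m lin w').

Definition iw_inv n (w : iw n) : iw n :=
  IW (- (invmx (lin w) *m trans w)) (invmx (lin w)).

Definition translation n (t : cochar n) : iw n := IW t 1%:M.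

Definition toQ n (v : cochar n) : 'cV[rat]_n := map_mx (intr : int -> rat) v.

Section BasedRootDatum.

Variables (n : nat) (D : based_root_datum n).

Definition irreducible_root_system : Prop :=
  Phi D <> fset0%fset /\
  forall A B : {fset char n}, (A `|` B)%fset = Phi D ->
    (forall a b, a \in A -> b \in B -> pairing a (coroot D b) = 0) ->
    A = fset0%fset \/ B = fset0%fset.

Definition pos_roots : {fset char n} :=
  [fset a in Phi D | `[< nonneg_comb (Delta D) a >]]%fset.

Definition weyl : set 'M[int]_n :=
  [set u | exists2 s : seq (char n), {subset s <= Phi D} &
           u = \prod_(a <- s) refl_mx a (coroot D a)].

Definition weyl_orbit (mu : cochar n) : set (cochar n) :=
  [set u *m mu | u in weyl].

Definition iw_sigma (w : iw n) : iw n :=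
  IW (sigma D *m trans w) (sigma D *m lin w *m invmx (sigma D)).

Definition highest_root (a : char n) : Prop :=
  a \in pos_roots /\ forall b, b \in Phi D -> nonneg_comb (Delta D) (a - b).

Definition PiSet : set (char n) :=
  [set - d | d in [set` Delta D]] `|` highest_root.

(* An affine function on X_*(T)_R is determined by its restriction to X_*(T), *)
(* so affine roots are functions on the lattice.                              *)
Definition affine_root (a : char n) (k : int) : cochar n -> int :=
  fun v => - pairing a v + k.

Definition tilde_root (a : char n) : cochar n -> int :=
  affine_root a (if a \in pos_roots then 1 else 0).

Definition Omega : set (iw n) :=
  [set w | weyl (lin w) /\
     [set f \o iw_act (iw_inv w) | f in tilde_root @` PiSet]
       = tilde_root @` PiSet].

Definition OmegaJ (b : iw n) : set (iw n) :=
  [set w | Omega w /\ iw_mul (iw_mul b (iw_sigma w)) (iw_inv b) = w].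

Definition dominant (mu : cochar n) : Prop :=
  forall a, a \in pos_roots -> 0 <= pairing a mu.

Definition minuscule (mu : cochar n) : Prop :=
  forall a, a \in Phi D -> `|pairing a mu| <= 1.

Definition dominantQ (nu : 'cV[rat]_n) : Prop :=
  forall a, a \in pos_roots ->
    0 <= (map_mx (intr : int -> rat) a *m nu) 0 0.

Definition leQ (nu nu' : 'cV[rat]_n) : Prop :=
  exists2 c : char n -> rat, (forall a, 0 <= c a) &
    nu' - nu = \sum_(a <- pos_roots) c a *: toQ (coroot D a).

Definition diamond (nu : 'cV[rat]_n) : 'cV[rat]_n :=
  (sdeg D)%:R^-1 *:
  \sum_(i < sdeg D) map_mx (intr : int -> rat) (sigma D ^+ i) *m nu.

(* The Kottwitz map takes varpi^t u to the class of t in                      *)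
(* pi_1(G)_sigma = X_*(T) / (Z Phi^vee + (sigma - 1) X_*(T)); classes are     *)
(* represented as cosets.                                                     *)
Definition kottwitz (w : iw n) : set (cochar n) :=
  [set x | exists (m : char n -> int) (y : cochar n),
     x = trans w + \sum_(a <- Phi D) coroot D a *~ m a + (sigma D *m y - y)].

(* b sigma(b) ... sigma^(m-1)(b), the W~-component of (b sigma)^m *)
Definition sigma_norm (b : iw n) (m : nat) : iw n :=
  iter m (fun w => iw_mul b (iw_sigma w)) (translation 0).

(* If sigma^m = 1 and (b sigma)^m = varpi^t with m > 0, then the Newton point *)
(* of b is the dominant element of the W_0-orbit of t / m.                    *)
Definition is_newton_point (b : iw n) (nu : 'cV[rat]_n) : Prop :=
  dominantQ nu /\
  exists (m : nat) (t : cochar n) (u : 'M[int]_n),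
    [/\ (0 < m)%N, sigma D ^+ m = 1%:M, sigma_norm b m = translation t,
        weyl u & nu = m%:R^-1 *: toQ (u *m t)].

Definition newton (b : iw n) : 'cV[rat]_n := xget 0 (is_newton_point b).

Definition in_BGmu (mu : cochar n) (b : iw n) : Prop :=
  kottwitz b = kottwitz (translation mu) /\
  leQ (newton b) (diamond (toQ mu)).

(* This is minus the value of tilde_root a at lam. *)
Definition shifted_pairing (lam : cochar n) (a : char n) : int :=
  if a \in pos_roots then pairing a lam - 1 else pairing a lam.

Definition natural (b : iw n) (lam : cochar n) : cochar n :=
  iw_act b (sigma D *m lam) - lam.

Definition Amub (mu : cochar n) (b : iw n) : set (cochar n) :=
  [set lam | weyl_orbit mu (natural b lam)].

Definition is_epsilon (lam : cochar n) (e : 'M[int]_n) : Prop :=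
  weyl e /\
  [set a | a \in Phi D /\ 0 <= shifted_pairing lam a]
    = char_act e @` [set` pos_roots].

Definition epsilon (lam : cochar n) : 'M[int]_n := xget 1%:M (is_epsilon lam).

Definition flat (b : iw n) (lam : cochar n) : cochar n :=
  invmx (epsilon lam) *m natural b lam.

Definition OmegaJ_orbit (b : iw n) (lam : cochar n) : set (cochar n) :=
  [set iw_act w lam | w in OmegaJ b].

Definition OmegaJ_quot_Amub (mu : cochar n) (b : iw n) : set (set (cochar n)) :=
  OmegaJ_orbit b @` Amub mu b.

Definition flat_target (mu : cochar n) (b : iw n) : set (cochar n) :=
  [set nu | weyl_orbit mu nu /\ leQ (diamond (toQ nu)) (newton b)].

End BasedRootDatum.

(* Main.v *)
(* Fix a rational point v of the base alcove.  Then lam_alpha >= 0 if and only  *)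
(* if <alpha, lam - v> > 0, so eps_lam is the element of W_0 taking the         *)
(* dominant chamber to the chamber of lam - v; since Omega preserves the base   *)
(* alcove, eps_(w lam) = lin(w) eps_lam for w in Omega, whence the invariance   *)
(* of flat.  For the bound on the diamond-average, some power of b sigma is a   *)
(* translation, so averaging a (b sigma)-orbit gives a v in the base alcove     *)
(* with b sigma v = v + z; here z is killed by all roots and equals nu_b.  If   *)
(* y = eps_lam^-1 (lam - v), then y and sigma y are regular dominant and        *)
(*   lam^flat = u sigma y - y + z <= sigma y - y + z    for some u in W_0.      *)
(* The diamond-average kills sigma y - y and fixes z.                           *)

Require Import Defs.
From mathcomp Require Import all_boot all_order all_algebra all_fingroup.
From mathcomp Require Import finmap lra zify.
From mathcomp Require Import boolp classical_sets functions.

Set Implicit Arguments.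
Unset Strict Implicit.
Unset Printing Implicit Defensive.

Import Order.TTheory GRing.Theory Num.Theory.
Local Open Scope ring_scope.

(** Invariance of [flat] rests on a geometric reading of [epsilon]: for any [v] in the base alcove,
    [epsilon D lam] carries the dominant chamber to the chamber of lam - v ([is_epsilonP]). As
    [Omega] preserves the alcove ([in_alcove_Omega]), [v] may be replaced by its image under [w];
    hence [epsilon] and [natural] are both multiplied by [lin w] ([epsilon_iw_act],
    [natural_iw_act]), and [flat] does not change ([flat_iw_act]).

    The bound combines a point of the alcove that b sigma moves by the central vector nu_b
    ([newton_fixed_point]) with the maximality of a regular dominant vector in its Weyl orbit
    ([weyl_regular_dominant_max]); see [flat_diamond_le].

    Both halves use that W_0 acts simply transitively on chambers, which is derived from the axioms
    of the root datum by way of the exchange condition ([weyl_chamber], [word_exchange],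
    [weyl_pos_stable]). Characters are rows, so [a *m u] is the image of [a] under the inverse of
    [u]. *)

Lemma invmx_eq (R : comUnitRingType) n (A B : 'M[R]_n) :
  A *m B = 1%:M -> invmx A = B.
Proof.
move=> AB; have [Au _] := mulmx1_unit AB.
by rewrite -[RHS](mulKmx Au) AB mulmx1.
Qed.

(** * Calculus of the integral pairing *)

Section Basics.
Variable n : nat.
Implicit Types (a f : 'rV[int]_n) (c x : 'cV[int]_n) (u g : 'M[int]_n).

Lemma mul_pairing a c x : c *m (a *m x) = c *~ pairing a x.
Proof. by rewrite [a *m x]mx11_scalar mul_mx_scalar -scaler_int intz. Qed.

Lemma refl_mxE a c x : refl_mx a c *m x = x - c *~ pairing a x.
Proof. by rewrite mulmxBl mul1mx -mulmxA mul_pairing. Qed.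

Lemma pairing_mul f u x : pairing (f *m u) x = pairing f (u *m x).
Proof. by rewrite /pairing mulmxA. Qed.

Lemma mul_refl_mx a c f : f *m refl_mx a c = f - a *~ pairing f c.
Proof.
by rewrite mulmxBr mulmx1 mulmxA [f *m c]mx11_scalar mul_scalar_mx -scaler_int intz.
Qed.

Lemma pairingDl f f' x : pairing (f + f') x = pairing f x + pairing f' x.
Proof. by rewrite /pairing mulmxDl mxE. Qed.

Lemma pairingNl f x : pairing (- f) x = - pairing f x.
Proof. by rewrite /pairing mulNmx mxE. Qed.

Lemma pairingMz f k x : pairing (f *~ k) x = k * pairing f x.
Proof. by rewrite /pairing -scaler_int intz -scalemxAl mxE. Qed.

Lemma pairingDr f x y : pairing f (x + y) = pairing f x + pairing f y.
Proof. by rewrite /pairing mulmxDr mxE. Qed.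

Lemma pairing_sum (I : Type) (r : seq I) (E : I -> 'rV[int]_n) x :
  pairing (\sum_(i <- r) E i) x = \sum_(i <- r) pairing (E i) x.
Proof. by rewrite /pairing mulmx_suml summxE. Qed.

Lemma mulrz_row_eq0 f k : f != 0 -> f *~ k = 0 -> k = 0.
Proof.
move=> f0 fk; apply/eqP; apply: contraTT f0 => k0; rewrite negbK.
apply/eqP/rowP => i; move/rowP/(_ i): fk; rewrite -scaler_int intz !mxE => /eqP.
by rewrite mulf_eq0 (negPf k0) => /eqP.
Qed.

Lemma pairing_ext f f' : (forall x, pairing f x = pairing f' x) -> f = f'.
Proof.
move=> E; apply/rowP => i; have := E (delta_mx i 0).
by rewrite /pairing -!colE !mxE.
Qed.

End Basics.

(** * Reflections and the Weyl group acting on roots and coroots *)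

Section Roots.
Variables (n : nat) (D : based_root_datum n).
Implicit Types (a b d f : 'rV[int]_n) (u : 'M[int]_n).
Local Notation Phi := (Phi D).
Local Notation Delta := (Delta D).
Local Notation coroot := (coroot D).
Local Notation pos := (pos_roots D).
Local Notation refl a := (refl_mx a (coroot a)).

Lemma mul_refl_self a : a \in Phi -> a *m refl a = - a.
Proof.
by move=> aP; rewrite mul_refl_mx pairing_coroot // -pmulrn mulr2n opprD addrA subrr sub0r.
Qed.

Lemma refl_mxK a : a \in Phi -> refl a *m refl a = 1%:M.
Proof.
move=> aP; rewrite {1}/refl_mx mulmxBl mul1mx -mulmxA mul_refl_self //.
by rewrite /refl_mx mulmxN opprK subrK.
Qed.

Lemma mul_refl_root a b : a \in Phi -> b \in Phi -> b *m refl a \in Phi.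
Proof. by move=> aP bP; rewrite mul_refl_mx refl_root. Qed.

Lemma oppr_root a : a \in Phi -> - a \in Phi.
Proof. by move=> aP; rewrite -mul_refl_self ?mul_refl_root. Qed.

Lemma root_neq0 a : a \in Phi -> a != 0.
Proof.
move=> aP; apply/eqP => a0; have := pairing_coroot aP.
by rewrite a0 /pairing mul0mx mxE.
Qed.

Lemma weyl1 : weyl D 1%:M.
Proof. by exists [::] => //; rewrite big_nil. Qed.

Lemma weyl_refl a : a \in Phi -> weyl D (refl a).
Proof.
move=> aP; exists [:: a]; last by rewrite big_seq1.
by move=> b; rewrite inE => /eqP ->.
Qed.

Lemma weylM u u' : weyl D u -> weyl D u' -> weyl D (u *m u').
Proof.
move=> [s sP ->] [s' sP' ->]; exists (s ++ s'); last by rewrite big_cat.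
by move=> a; rewrite mem_cat => /orP[/sP|/sP'].
Qed.

Lemma weyl_ind (P : 'M[int]_n -> Prop) : P 1%:M ->
  (forall a u, a \in Phi -> weyl D u -> P u -> P (refl a *m u)) ->
  forall u, weyl D u -> P u.
Proof.
move=> P1 PM _ [s + ->]; elim: s => [_|a s IHs sP]; first by rewrite big_nil.
have sP' : {subset s <= Phi} by move=> b bs; rewrite sP // inE bs orbT.
rewrite big_cons; apply: PM; [by rewrite sP ?mem_head | by exists s | exact: IHs].
Qed.

Lemma weyl_unit u : weyl D u -> u \in unitmx.
Proof.
elim/weyl_ind => [|a {}u aP _ uu]; first exact: unitmx1.
by rewrite unitmx_mul uu andbT; case/mulmx1_unit: (refl_mxK aP).
Qed.

Lemma weylV u : weyl D u -> weyl D (invmx u).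
Proof.
elim/weyl_ind => [|a {}u aP uW IHu].
  by rewrite (invmx_eq (mulmx1 _)); exact: weyl1.
suff -> : invmx (refl a *m u) = invmx u *m refl a by apply: weylM (weyl_refl aP).
by apply: invmx_eq; rewrite mulmxA mulmxK ?weyl_unit // refl_mxK.
Qed.

Lemma weyl_root u a : weyl D u -> a \in Phi -> a *m u \in Phi.
Proof.
move=> uW; elim/weyl_ind: uW a => [a|b {}u bP _ IHu a aP]; first by rewrite mulmx1.
by rewrite mulmxA IHu // mul_refl_root.
Qed.

(* If [c] is the root with coroot [s_a b^vee], then the product of [s_a s_b s_a]
   and [s_c] maps [c] to [c + 2 (c - s_a b)] and fixes [c - s_a b]: by finiteness
   of [Phi] the two roots agree. *)
Lemma coroot_mul_refl a b : a \in Phi -> b \in Phi ->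
  coroot (b *m refl a) = refl a *m coroot b.
Proof.
move=> aP bP; have [c cP cE] := refl_coroot aP bP.
rewrite -refl_mxE in cE; rewrite -cE; congr (coroot _).
set b' := b *m refl a; set e := c - b'.
pose t := refl a *m refl b *m refl a *m refl c.
have tP f : f \in Phi -> f *m t \in Phi.
  by move=> fP; rewrite /t !mulmxA !mul_refl_root.
have b'c : pairing b' (coroot c) = 2.
  by rewrite /b' pairing_mul cE mulmxA refl_mxK // mul1mx pairing_coroot.
have tE f : f *m t = f + e *~ pairing f (coroot c).
  rewrite /t; have -> : refl a *m refl b *m refl a = refl_mx b' (coroot c).
    rewrite [refl b]/refl_mx (mulmxBr (refl a) 1%:M) mulmx1 mulmxBl refl_mxK // cE.
    by rewrite /refl_mx /b' !mulmxA.
  rewrite mulmxA !mul_refl_mx pairingDl pairingNl pairingMz b'c.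
  set k := pairing f _; rewrite /e mulrzBl -!addrA; congr (_ + _).
  by rewrite [RHS]addrC; congr (_ + _); rewrite -mulrNz; congr (_ *~ _); lia.
have orb k : c + e *~ (2 * k%:Z) \in Phi.
  elim: k => [|k IHk]; first by rewrite mulr0 mulr0z addr0.
  have := tP _ IHk; rewrite tE pairingDl pairingMz pairingDl pairingNl b'c.
  rewrite pairing_coroot // subrr mulr0 addr0 -addrA -mulrzDr.
  by rewrite (_ : _ + 2 = 2 * k.+1%:Z) //; lia.
apply/eqP; rewrite eq_sym -subr_eq0 -/e; apply/negPn/negP => e0.
pose s := [seq c + e *~ (2 * k%:Z) | k <- iota 0 (size Phi).+1].
have us : uniq s.
  rewrite map_inj_uniq ?iota_uniq // => i j /addrI/eqP.
  by rewrite -subr_eq0 -mulrzBr => /eqP/(mulrz_row_eq0 e0); lia.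
have := uniq_leq_size us (_ : {subset s <= Phi}).
rewrite size_map size_iota ltnn => abs; apply: notF.
by apply: abs => f /mapP[k _ ->].
Qed.


Lemma coroot_weyl u a : weyl D u -> a \in Phi ->
  coroot (a *m u) = invmx u *m coroot a.
Proof.
move=> uW; elim/weyl_ind: uW a => [a _|b {}u bP uW IHu a aP].
  by rewrite mulmx1 (invmx_eq (mulmx1 _)) mul1mx.
have [ru _] := mulmx1_unit (refl_mxK bP).
rewrite mulmxA IHu ?mul_refl_root // coroot_mul_refl // mulmxA.
congr (_ *m _); apply/esym/invmx_eq.
by rewrite mulmxA mulmxK ?(weyl_unit uW) // refl_mxK.
Qed.

Lemma refl_weyl u a : weyl D u -> a \in Phi ->
  refl (a *m u) = invmx u *m refl a *m u.
Proof.
move=> uW aP; rewrite coroot_weyl // /refl_mx mulmxBr mulmxBl mulmx1.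
by rewrite mulVmx ?(weyl_unit uW) // !mulmxA.
Qed.

Lemma coroot_opp a : a \in Phi -> coroot (- a) = - coroot a.
Proof.
move=> aP; rewrite -mul_refl_self // coroot_mul_refl // refl_mxE.
by rewrite pairing_coroot // -pmulrn mulr2n opprD addrA subrr sub0r.
Qed.

Lemma refl_opp a : a \in Phi -> refl (- a) = refl a.
Proof. by move=> aP; rewrite coroot_opp // /refl_mx mulmxN mulNmx opprK. Qed.

(** * Positive and simple roots *)

Lemma nonneg_combD a b : nonneg_comb Delta a -> nonneg_comb Delta b ->
  nonneg_comb Delta (a + b).
Proof.
move=> [m ->] [m' ->]; exists (fun d => m d + m' d)%N.
by rewrite -big_split; apply: eq_bigr => d _; rewrite mulrnDr.
Qed.

Lemma nonneg_comb_opp a : nonneg_comb Delta a -> nonneg_comb Delta (- a) -> a = 0.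
Proof.
move=> [m aE] [m' naE].
have E d : d \in Delta -> (m d)%:Z + (m' d)%:Z = 0.
  move: d; apply: (Delta_free (m := fun d => (m d)%:Z + (m' d)%:Z)).
  rewrite -[RHS](subrr a) {1}aE naE -big_split.
  by apply: eq_bigr => d _; rewrite mulrzDr.
rewrite aE big_seq big1 // => d /E h; rewrite (_ : m d = 0%N) //; lia.
Qed.

Lemma nonneg_comb_simple d : d \in Delta -> nonneg_comb Delta d.
Proof.
move=> dD; exists (fun c => (c == d) : nat).
rewrite (bigD1_seq d) ?fset_uniq //= eqxx mulr1n big1 ?addr0 // => c /negPf ->.
by rewrite mulr0n.
Qed.

Lemma pos_rootP a : reflect (a \in Phi /\ nonneg_comb Delta a) (a \in pos).
Proof.
rewrite /pos_roots !inE /=; apply: (iffP andP) => -[aP /asboolP]; split=> //.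
Qed.

Lemma pos_root a : a \in pos -> a \in Phi.
Proof. by case/pos_rootP. Qed.

Lemma simple_pos d : d \in Delta -> d \in pos.
Proof.
by move=> dD; apply/pos_rootP; split; [exact: Delta_sub | exact: nonneg_comb_simple].
Qed.

Lemma root_pos_or_neg a : a \in Phi -> a \in pos \/ - a \in pos.
Proof.
move=> aP; case: (Delta_base aP) => h; [left | right]; apply/pos_rootP => //.
by split=> //; exact: oppr_root.
Qed.

Lemma pos_rootN a : a \in pos -> - a \notin pos.
Proof.
move=> /pos_rootP[aP ap]; apply/negP => /pos_rootP[_ an].
by have := root_neq0 aP; rewrite (nonneg_comb_opp ap an) eqxx.
Qed.

(* Some simple [c <> d] occurs in [a] since [Phi] is reduced; its coefficient is
   the same in [a] and in [s_d a]. *)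
Lemma simple_refl_pos d a : d \in Delta -> a \in pos -> a != d ->
  a *m refl d \in pos.
Proof.
move=> dD /pos_rootP[aP [m aE]] ad; have dP := Delta_sub dD.
have [rP|/pos_rootP[_ [m' rE]]] := root_pos_or_neg (mul_refl_root dP aP).
  by [].
pose k := pairing a (coroot d).
have E c : c \in Delta -> (m c)%:Z + (m' c)%:Z - (if c == d then k else 0) = 0.
  move: c.
  apply: (Delta_free (m := fun c => (m c)%:Z + (m' c)%:Z - (if c == d then k else 0))).
  transitivity (a - a *m refl d - d *~ k); last first.
    by rewrite mul_refl_mx subKr subrr.
  rewrite rE aE -big_split /=.
  rewrite (_ : d *~ k = \sum_(c <- Delta) c *~ (if c == d then k else 0)); last first.
    rewrite (bigD1_seq d) ?fset_uniq //= eqxx big1 ?addr0 // => c /negPf ->.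
    by rewrite mulr0z.
  by rewrite -sumrB; apply: eq_bigr => c _; rewrite mulrzBr mulrzDr.
have aE' : a = d *+ m d.
  rewrite aE (bigD1_seq d) ?fset_uniq //= big_seq_cond.
  rewrite big1 ?addr0 // => c /andP[/E + /negPf cd].
  by rewrite cd subr0 => h; rewrite (_ : m c = 0%N) //; lia.
have md : pairing d (coroot a) * (m d)%:Z = 2.
  by rewrite mulrC -pairingMz -pmulrn -aE' pairing_coroot.
have : (m d == 1%N) || (m d == 2%N).
  have: (m d %| 2)%N.
    by have := dvdz_mull (pairing d (coroot a)) (dvdzz (m d)); rewrite md.
  by case: (m d) => [|[|[|k']]] // /dvdn_leq -/(_ isT).
move=> /orP[]/eqP mdE; first by rewrite aE' mdE mulr1n eqxx in ad.
by have := reduced dP; rewrite -mdE -aE' aP.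
Qed.

(** The canonical W_0-invariant symmetric form on characters. It is positive on roots and serves as
    their scalar product. *)
Definition coroot_form f g : int :=
  \sum_(b <- Phi) pairing f (coroot b) * pairing g (coroot b).

Lemma coroot_formDr f g h :
  coroot_form f (g + h) = coroot_form f g + coroot_form f h.
Proof.
by rewrite -big_split; apply: eq_bigr => b _; rewrite pairingDl mulrDr.
Qed.

Lemma coroot_formNr f g : coroot_form f (- g) = - coroot_form f g.
Proof.
by rewrite -sumrN; apply: eq_bigr => b _; rewrite pairingNl mulrN.
Qed.

Lemma coroot_formMzr f g k : coroot_form f (g *~ k) = k * coroot_form f g.
Proof.
by rewrite big_distrr; apply: eq_bigr => b _; rewrite pairingMz /= mulrCA.
Qed.

Lemma coroot_formC f g : coroot_form f g = coroot_form g f.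
Proof. by apply: eq_bigr => b _; rewrite mulrC. Qed.

Lemma coroot_form_refl a f g : a \in Phi ->
  coroot_form (f *m refl a) (g *m refl a) = coroot_form f g.
Proof.
move=> aP; pose s b := b *m refl a.
have sK b : s (s b) = b by rewrite /s -mulmxA refl_mxK // mulmx1.
have perm_s : perm_eq [seq s b | b <- Phi] Phi.
  apply: uniq_perm; rewrite ?(map_inj_uniq (can_inj sK)) ?fset_uniq //.
  move=> b; apply/mapP/idP => [[c cP ->]|bP]; first exact: mul_refl_root.
  by exists (s b); rewrite ?sK //; apply: mul_refl_root.
rewrite /coroot_form -[RHS](perm_big _ perm_s) big_map.
rewrite big_seq [RHS]big_seq; apply: eq_bigr => b bP.
by rewrite /s coroot_mul_refl // !pairing_mul.
Qed.

(** Invariance under s_a gives (f, a) = (f - k a, -a) with k the pairing of [f] with the coroot of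
    [a]. *)
Lemma coroot_form_root a f : a \in Phi ->
  2 * coroot_form f a = pairing f (coroot a) * coroot_form a a.
Proof.
move=> aP; have := coroot_form_refl f a aP.
rewrite mul_refl_self // coroot_formNr mul_refl_mx coroot_formC.
rewrite coroot_formDr coroot_formNr coroot_formMzr (coroot_formC a f).
lia.
Qed.

Lemma coroot_form_gt0 a : a \in Phi -> 0 < coroot_form a a.
Proof.
move=> aP; rewrite /coroot_form (bigD1_seq a) ?fset_uniq //= pairing_coroot //.
by apply: ltr_wpDr => //; apply: sumr_ge0 => b _; rewrite -expr2 sqr_ge0.
Qed.

(** Otherwise every (a, d) with [d] simple is at most 0, and expanding the second argument of (a, a)
    in simple roots contradicts (a, a) > 0. *)
Lemma simple_pairing_gt0 a : a \in pos ->
  exists2 d, d \in Delta & 0 < pairing a (coroot d).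
Proof.
move=> /pos_rootP[aP [m aE]]; apply: contrapT => noD.
have : coroot_form a a <= 0; last by rewrite leNgt coroot_form_gt0.
rewrite {2}aE.
have -> : coroot_form a (\sum_(d <- Delta) d *+ m d) =
    \sum_(d <- Delta) coroot_form a d * (m d)%:Z.
  elim/big_rec2: _ => [|d x y _ <-]; last first.
    by rewrite coroot_formDr pmulrn coroot_formMzr mulrC.
  by rewrite -[0 in LHS](subrr a) coroot_formDr coroot_formNr subrr.
rewrite big_seq; apply: sumr_le0 => d dD; have dP := Delta_sub dD.
rewrite mulr_le0_ge0 //.
have ad : pairing a (coroot d) <= 0.
  by rewrite leNgt; apply/negP => ad; apply: noD; exists d.
have := mulr_le0_ge0 ad (ltW (coroot_form_gt0 dP)).
by rewrite -coroot_form_root // pmulr_rle0.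
Qed.

(** * The rational pairing and a height function *)

Definition pairingQ f (v : 'cV[rat]_n) : rat := (map_mx intr f *m v) 0 0.
Local Notation qmx u := (map_mx (intr : int -> rat) u).
Implicit Types v : 'cV[rat]_n.

Lemma pairingQ_mul f u v : pairingQ (f *m u) v = pairingQ f (qmx u *m v).
Proof. by rewrite /pairingQ map_mxM mulmxA. Qed.

Lemma pairingQDl f g v : pairingQ (f + g) v = pairingQ f v + pairingQ g v.
Proof. by rewrite /pairingQ map_mxD mulmxDl mxE. Qed.

Lemma pairingQNl f v : pairingQ (- f) v = - pairingQ f v.
Proof. by rewrite /pairingQ map_mxN mulNmx mxE. Qed.

Lemma pairingQMzl f k v : pairingQ (f *~ k) v = k%:~R * pairingQ f v.
Proof.
by rewrite -scaler_int intz /pairingQ map_mxZ -scalemxAl mxE.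
Qed.

Lemma pairingQDr f v v' : pairingQ f (v + v') = pairingQ f v + pairingQ f v'.
Proof. by rewrite /pairingQ mulmxDr mxE. Qed.

Lemma pairingQNr f v : pairingQ f (- v) = - pairingQ f v.
Proof. by rewrite /pairingQ mulmxN mxE. Qed.

Lemma pairingQZr f k v : pairingQ f (k *: v) = k * pairingQ f v.
Proof. by rewrite /pairingQ -scalemxAr mxE. Qed.

Lemma pairingQ_sumr (I : Type) (r : seq I) (P : pred I) (E : I -> 'cV[rat]_n) f :
  pairingQ f (\sum_(i <- r | P i) E i) = \sum_(i <- r | P i) pairingQ f (E i).
Proof. by rewrite /pairingQ mulmx_sumr summxE. Qed.

Lemma pairingQ_toQ f (x : 'cV[int]_n) : pairingQ f (toQ x) = (pairing f x)%:~R.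
Proof. by rewrite /pairingQ /toQ -map_mxM mxE. Qed.

Lemma pairingQ_comb (m : 'rV[int]_n -> nat) v :
  pairingQ (\sum_(d <- Delta) d *+ m d) v = \sum_(d <- Delta) pairingQ d v *+ m d.
Proof.
elim/big_rec2: _ => [|d x y _ <-]; first by rewrite /pairingQ map_mx0 mul0mx mxE.
by rewrite pairingQDl pmulrn pairingQMzl mulr_natl.
Qed.

Lemma rat_row_denom m (v : 'rV[rat]_m) :
  exists2 N : int, N != 0 & exists w : 'rV[int]_m, N%:~R *: v = qmx w.
Proof.
exists (\prod_i denq (v 0 i)).
  by apply/prodf_neq0 => i _; rewrite denq_neq0.
exists (\row_i (numq (v 0 i) * \prod_(j | j != i) denq (v 0 j))).
apply/rowP => i; rewrite !mxE (bigD1 i) //= !rmorphM /= numqE.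
by rewrite mulrAC; congr (_ * _); rewrite mulrC.
Qed.

(** [Delta_free] is independence over the integers; clearing denominators gives it over the
    rationals. The matrix with the simple roots as rows thus has a right inverse, which is applied
    to the all-ones vector. *)
Lemma simple_coweight : exists rho, forall d, d \in Delta -> pairingQ d rho = 1.
Proof.
pose M : 'M[rat]_(size Delta, n) := \matrix_i qmx (nth 0 Delta i).
have /row_freeP[B MB] : row_free M.
  apply: inj_row_free => v vM; have [N N0 [w vw]] := rat_row_denom v.
  suff w0 : w = 0.
    apply/eqP; move/eqP: vw; rewrite w0 map_mx0 scaler_eq0 intr_eq0.
    by rewrite (negPf N0).
  (* The coefficients are moved from row indices to characters, with value 0 off [Delta]. *)
  pose c d := if insub (index d Delta) is Some i then w 0 i else 0.
  have cE (i : 'I_(size Delta)) : c (nth 0 Delta i) = w 0 i.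
    by rewrite /c index_uniq ?fset_uniq // insubT //= => ?; congr (w 0 _); apply: val_inj.
  have cD : \sum_(d <- Delta) d *~ c d = 0.
    rewrite (big_nth 0) big_mkord.
    have /rowP wM : qmx w *m M = 0 by rewrite -vw -scalemxAl vM scaler0.
    apply/rowP => j; have := wM j; rewrite !mxE => wMj.
    apply: (intr_inj (R := rat)); rewrite summxE rmorph_sum -[RHS]wMj.
    apply: eq_bigr => i _.
    by rewrite cE -scaler_int intz !mxE rmorphM.
  apply/rowP => i; rewrite -cE mxE; apply: Delta_free cD _ _.
  by apply: mem_nth.
exists (B *m const_mx 1) => d dD.
have id : (index d Delta < size Delta)%N by rewrite index_mem.
have -> : d = nth 0 Delta (Ordinal id) by rewrite nth_index.
rewrite /pairingQ mulmxA.
have -> : qmx (nth 0 Delta (Ordinal id)) = row (Ordinal id) M by rewrite rowK.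
by rewrite -row_mul MB -row_mul mul1mx !mxE.
Qed.

(** * Simple reflections generate W_0, and the stabilizer of the positive roots is trivial *)

Local Notation word s := (\prod_(d <- s) refl d).

Lemma weyl_word s : {subset s <= Delta} -> weyl D (word s).
Proof. by move=> sD; exists s => // d /sD; apply: Delta_sub. Qed.

Lemma invmx_word s : {subset s <= Delta} -> invmx (word s) = word (rev s).
Proof.
elim: s => [|d s IHs] sD; first by rewrite big_nil; exact: invmx_eq (mulmx1 _).
have dD : d \in Delta by rewrite sD ?mem_head.
have sD' : {subset s <= Delta} by move=> c cs; rewrite sD // inE cs orbT.
apply: invmx_eq; rewrite rev_cons -cats1 big_cat big_seq1 big_cons /= -IHs //.
change (refl d *m word s *m (invmx (word s) *m refl d) = 1%:M).
by rewrite mulmxA mulmxK ?(weyl_unit (weyl_word sD')) // refl_mxK ?Delta_sub.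
Qed.

(** Induction on a bound for the height of [a]: reflecting in a simple root that pairs positively
    with [a] lowers the height by at least 1 and, unless [a] is that root, keeps [a] positive. *)
Lemma pos_root_conj a : a \in pos ->
  exists2 s, {subset s <= Delta} & a *m word s \in Delta.
Proof.
have [rho rhoE] := simple_coweight => aP.
have rho0 b : b \in pos -> 0 <= pairingQ b rho.
  case/pos_rootP => _ [m ->]; rewrite pairingQ_comb big_seq.
  by apply: sumr_ge0 => d /rhoE ->; rewrite mulrn_wge0.
have [N] : exists N : nat, pairingQ a rho < N%:R.
  by exists (Num.bound (pairingQ a rho)); apply: archi_boundP; exact: rho0.
elim: N a aP => [|N IHN] a aP aN; first by have := rho0 _ aP; rewrite leNgt aN.
have [d dD ad] := simple_pairing_gt0 aP.
have [->|a_neq_d] := eqVneq a d.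
  by exists [::] => //; rewrite big_nil mulmx1.
have [||s sD asD] := IHN (a *m refl d); first exact: simple_refl_pos.
  rewrite mul_refl_mx pairingQDl pairingQNl pairingQMzl (rhoE d dD) mulr1.
  have : (1 : rat) <= (pairing a (coroot d))%:~R by rewrite -[1]/(1%:~R) ler_int; lia.
  move: aN; rewrite -natr1; lra.
exists (d :: s); first by move=> c; rewrite inE => /predU1P[->|/sD].
by rewrite big_cons mulmxA.
Qed.

Lemma weyl_simple u : weyl D u -> exists2 s, {subset s <= Delta} & u = word s.
Proof.
elim/weyl_ind => [|a {}u aP _ [s sD ->]]; first by exists [::]; rewrite ?big_nil.
suff [t tD ->] : exists2 t, {subset t <= Delta} & refl a = word t.
  exists (t ++ s); last by rewrite big_cat.
  by move=> c; rewrite mem_cat => /orP[/tD|/sD].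
wlog ap : a aP / a \in pos.
  move=> hw; have [/hw|ap] := root_pos_or_neg aP; first exact.
  by have [||t tD E] := hw (- a); [exact: oppr_root | | exists t; rewrite -1?refl_opp].
have [t tD dD] := pos_root_conj ap.
(* With [d] the simple root [a *m word t], s_a is the conjugate of s_d by [word t]. *)
exists (t ++ (a *m word t) :: rev t).
  by move=> c; rewrite mem_cat inE mem_rev => /or3P[/tD|/eqP ->|/tD].
have tW := weyl_word tD; have tu := weyl_unit tW.
rewrite big_cat big_cons /= -invmx_word // refl_weyl //.
change (refl a = word t *m (invmx (word t) *m refl a *m word t *m invmx (word t))).
by rewrite mulmxK // mulKVmx.
Qed.

(* The exchange condition. *)
Lemma word_exchange s a : {subset s <= Delta} -> a \in pos ->
  a *m word s \notin pos ->
  exists2 t, {subset t <= Delta} &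
    (size t).+1 = size s /\ refl a *m word s = word t.
Proof.
elim: s a => [|c s IHs] a sD ap; first by rewrite big_nil mulmx1 ap.
have cD : c \in Delta by rewrite sD ?mem_head.
have sD' : {subset s <= Delta} by move=> d ds; rewrite sD // inE ds orbT.
have [cP aP] := (Delta_sub cD, pos_root ap).
rewrite big_cons mulmxA; have [->|ac] := eqVneq a c.
  by move=> _; exists s => //; split=> //; rewrite mulmxA refl_mxK // mul1mx.
move=> /(IHs _ sD' (simple_refl_pos cD ap ac))[t tD [st E]].
exists (c :: t); first by move=> d; rewrite inE => /predU1P[->|/tD].
split; first by rewrite /= st.
rewrite big_cons -E refl_weyl //; last exact: weyl_refl.
rewrite (invmx_eq (refl_mxK cP)).
change (refl a *m (refl c *m word s)
  = refl c *m (refl c *m refl a *m refl c *m word s)).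
by rewrite -!mulmxA (mulmxA (refl c) (refl c)) refl_mxK // mul1mx.
Qed.

(** Induction on the length of a word for [u]. If its first letter is [d], positivity of [d *m u]
    makes [d] negative under the rest of the word, so the exchange condition writes [u] with two
    letters fewer. *)
Lemma weyl_pos_stable u : weyl D u -> (forall a, a \in pos -> a *m u \in pos) ->
  u = 1%:M.
Proof.
move=> /weyl_simple[s sD ->]; have [k] := ubnP (size s).
elim: k s sD => // k IHk [|d s] sD sk stab; first by rewrite big_nil.
have dD : d \in Delta by rewrite sD ?mem_head.
have sD' : {subset s <= Delta} by move=> c cs; rewrite sD // inE cs orbT.
have [|t tD [st E]] := word_exchange sD' (simple_pos dD).
  have := pos_rootN (stab _ (simple_pos dD)).
  by rewrite big_cons mulmxA mul_refl_self ?Delta_sub // mulNmx opprK.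
move: stab; rewrite big_cons.
change (refl d * word s) with (refl d *m word s); rewrite E => stab.
by apply: IHk => //; move: sk st; rewrite /=; lia.
Qed.

(** * The coroot cone and the Weyl chambers *)

Lemma toQ_mul u x : toQ (u *m x) = qmx u *m toQ x.
Proof. exact: map_mxM. Qed.

Lemma toQD (x y : 'cV[int]_n) : toQ (x + y) = toQ x + toQ y.
Proof. exact: map_mxD. Qed.

Lemma toQB (x y : 'cV[int]_n) : toQ (x - y) = toQ x - toQ y.
Proof. exact: map_mxB. Qed.

(** By definition, [leQ D nu nu'] is membership of nu' - nu in this cone. *)
Definition coroot_cone v : Prop :=
  exists2 c : 'rV[int]_n -> rat, (forall a, 0 <= c a) &
    v = \sum_(a <- pos) c a *: toQ (coroot a).

Lemma coroot_cone0 : coroot_cone 0.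
Proof. by exists (fun=> 0) => //; rewrite big1 // => a _; rewrite scale0r. Qed.

Lemma coroot_coneD v v' : coroot_cone v -> coroot_cone v' -> coroot_cone (v + v').
Proof.
move=> [c c0 ->] [c' c0' ->]; exists (fun a => c a + c' a).
  by move=> a; rewrite addr_ge0.
by rewrite -big_split; apply: eq_bigr => a _; rewrite scalerDl.
Qed.

Lemma coroot_coneZ k v : 0 <= k -> coroot_cone v -> coroot_cone (k *: v).
Proof.
move=> k0 [c c0 ->]; exists (fun a => k * c a); first by move=> a; rewrite mulr_ge0.
by rewrite scaler_sumr; apply: eq_bigr => a _; rewrite scalerA.
Qed.

Lemma coroot_cone_sum (I : eqType) (r : seq I) (E : I -> 'cV[rat]_n) :
  (forall i, i \in r -> coroot_cone (E i)) -> coroot_cone (\sum_(i <- r) E i).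
Proof.
move=> EC; rewrite big_seq; apply: big_ind => //; first exact: coroot_cone0.
exact: coroot_coneD.
Qed.

Lemma coroot_cone_pos a : a \in pos -> coroot_cone (toQ (coroot a)).
Proof.
move=> ap; exists (fun b => (b == a)%:R) => [b|]; first exact: ler0n.
rewrite (bigD1_seq a) ?fset_uniq //= eqxx scale1r big1 ?addr0 // => b /negPf ->.
by rewrite scale0r.
Qed.

Lemma qmx_refl d v : qmx (refl d) *m v = v - pairingQ d v *: toQ (coroot d).
Proof.
rewrite /refl_mx map_mxB map_mx1 map_mxM mulmxBl mul1mx -mulmxA.
by rewrite [qmx d *m v]mx11_scalar mul_mx_scalar.
Qed.

Lemma pairingQ_pos_simple v : (forall d, d \in Delta -> 0 <= pairingQ d v) ->
  forall a, a \in pos -> 0 <= pairingQ a v.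
Proof.
move=> vD a /pos_rootP[_ [m ->]]; rewrite pairingQ_comb big_seq.
by apply: sumr_ge0 => d /vD dv; rewrite mulrn_wge0.
Qed.

Definition regular_dominant v := forall a, a \in pos -> 0 < pairingQ a v.

Lemma regular_dominant_pos v a : regular_dominant v -> a \in Phi ->
  0 < pairingQ a v -> a \in pos.
Proof.
move=> vd aP av; have [//|/vd] := root_pos_or_neg aP.
by rewrite pairingQNl oppr_gt0 => /(lt_trans av); rewrite ltxx.
Qed.

Lemma regular_dominant_neq0 v a : regular_dominant v -> a \in Phi ->
  pairingQ a v != 0.
Proof.
move=> vd aP; have [/vd|/vd] := root_pos_or_neg aP; first by move/lt0r_neq0.
by rewrite pairingQNl oppr_gt0 => /ltr0_neq0.
Qed.

(** Reflect in a simple root [d] that is negative on [v]. This adds a positive multiple of the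
    coroot of [d], and it lowers the number of positive roots negative on [v], since s_d permutes
    the positive roots other than [d]. *)
Lemma weyl_chamber v : (forall a, a \in Phi -> pairingQ a v != 0) ->
  exists2 u, weyl D u &
    regular_dominant (qmx u *m v) /\ coroot_cone (qmx u *m v - v).
Proof.
pose N v := [seq a <- pos | pairingQ a v < 0].
have [k] := ubnP (size (N v)); elim: k v => // k IHk v vk vr.
have [[d dD dv]|noD] := pselect (exists2 d, d \in Delta & pairingQ d v < 0); last first.
  exists 1%:M; first exact: weyl1.
  rewrite map_mx1 mul1mx subrr; split; last exact: coroot_cone0.
  move=> a ap; rewrite lt_neqAle eq_sym vr ?pos_root //=.
  apply: pairingQ_pos_simple ap => d dD; rewrite leNgt; apply/negP => dv.
  by apply: noD; exists d.
have dP := Delta_sub dD; set v' := qmx (refl d) *m v.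
have v'E a : pairingQ a v' = pairingQ (a *m refl d) v by rewrite pairingQ_mul.
have refl_inj : injective (fun a => a *m refl d).
  apply: (@can_inj _ _ _ (fun a => a *m refl d)) => a.
  by rewrite -mulmxA refl_mxK ?mulmx1.
have lt_N : (size (N v') < size (N v))%N.
  rewrite -(size_map (fun a => a *m refl d) (N v')).
  (* s_d embeds the roots counted for [v'] among those counted for [v], and its image misses [d]. *)
  apply: (@uniq_leq_size _ (d :: _)).
    rewrite /= map_inj_uniq // filter_uniq ?fset_uniq // andbT.
    apply/negP => /mapP[a]; rewrite mem_filter => /andP[_ ap] dE.
    have aE : a = - d by apply: refl_inj; rewrite /= mulNmx mul_refl_self // opprK.
    by move: ap; rewrite aE (negPf (pos_rootN (simple_pos dD))).
  move=> b; rewrite inE => /predU1P[->|/mapP[a]].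
    by rewrite mem_filter dv simple_pos.
  rewrite !mem_filter v'E => /andP[av ap] ->; rewrite av simple_refl_pos //.
  apply: contraTneq av => ->; rewrite mul_refl_self // pairingQNl.
  by rewrite oppr_lt0 -leNgt ltW.
have [||u uW [ud uc]] := IHk v'; first by apply: leq_trans lt_N _.
  by move=> a aP; rewrite v'E vr // mul_refl_root.
exists (u *m refl d); first exact: weylM (weyl_refl dP).
rewrite map_mxM -mulmxA -/v'; split=> //.
rewrite -[_ - v](subrKA v'); apply: coroot_coneD uc _.
rewrite /v' qmx_refl addrAC subrr sub0r -scaleNr.
by apply: coroot_coneZ (coroot_cone_pos (simple_pos dD)); rewrite oppr_ge0 ltW.
Qed.

(** Moving [u v] into the dominant chamber by [weyl_chamber] adds an element of the cone, and by
    simple transitivity the result is [v] itself. *)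
Lemma weyl_regular_dominant_max u v : weyl D u -> regular_dominant v ->
  coroot_cone (v - qmx u *m v).
Proof.
move=> uW vd; have [|e eW [ed]] := @weyl_chamber (qmx u *m v).
  by move=> a aP; rewrite -pairingQ_mul regular_dominant_neq0 // weyl_root.
suff eu : e *m u = 1%:M by rewrite mulmxA -map_mxM eu map_mx1 mul1mx.
apply: weyl_pos_stable => [|a ap]; first exact: weylM.
apply: (regular_dominant_pos vd); first by rewrite weyl_root ?pos_root //; exact: weylM.
by rewrite pairingQ_mul map_mxM -mulmxA; exact: ed.
Qed.

(** * Frobenius on roots, W_0 and the cone *)

Lemma nonneg_comb_mul u a : (forall d, d \in Delta -> nonneg_comb Delta (d *m u)) ->
  nonneg_comb Delta a -> nonneg_comb Delta (a *m u).
Proof.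
move=> uD [m ->]; rewrite mulmx_suml big_seq.
have c0 : nonneg_comb Delta 0.
  by exists (fun=> 0%N); rewrite big1 // => d _; rewrite mulr0n.
apply: big_ind => //; first exact: nonneg_combD.
move=> d /uD dD; elim: (m d) => [|k IHk]; first by rewrite mulr0n mul0mx.
by rewrite mulrSr mulmxDl; apply: nonneg_combD.
Qed.

Local Notation sigma := (sigma D).

Lemma sigma_unit : sigma \in unitmx.
Proof.
have := sigma_sdeg D; rewrite -(prednK (sdeg_gt0 D)) exprS.
by case/mulmx1_unit.
Qed.

Lemma pos_root_sigmaV a : a \in pos -> a *m invmx sigma \in pos.
Proof.
move=> /pos_rootP[aP ap]; apply/pos_rootP; split; first exact: sigma_Phi.
apply: nonneg_comb_mul ap => d dD; apply: nonneg_comb_simple; exact: sigma_Delta.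
Qed.

Lemma sigma_expVr k : invmx sigma ^+ k *m sigma ^+ k = 1%:M.
Proof.
elim: k => [|k IHk]; first by rewrite !expr0 mulmx1.
rewrite exprS exprSr.
change (invmx sigma *m invmx sigma ^+ k *m (sigma ^+ k *m sigma) = 1%:M).
by rewrite mulmxA -(mulmxA (invmx sigma)) IHk mulmx1 mulVmx // sigma_unit.
Qed.

(** The root datum axioms speak of right multiplication by the inverse of [sigma]; this transfers
    their consequences to [sigma]. *)
Lemma sigma_powV : sigma = invmx sigma ^+ (sdeg D).-1.
Proof.
have := sigma_expVr (sdeg D); rewrite sigma_sdeg mulmx1.
rewrite -{1}(prednK (sdeg_gt0 D)) exprSr.
change (invmx sigma ^+ (sdeg D).-1 *m invmx sigma = 1%:M ->
  sigma = invmx sigma ^+ (sdeg D).-1).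
by move=> E; rewrite -[RHS]mulmx1 -(mulVmx sigma_unit) mulmxA E mul1mx.
Qed.

Lemma pos_root_sigma a : a \in pos -> a *m sigma \in pos.
Proof.
rewrite sigma_powV; elim: _.-1 => [|k IHk] ap; first by rewrite expr0 mulmx1.
by rewrite exprSr mulmxA pos_root_sigmaV // IHk.
Qed.

Lemma root_sigma a : a \in Phi -> a *m sigma \in Phi.
Proof.
case/root_pos_or_neg => [|ap]; first by move/pos_root_sigma/pos_root.
by rewrite -[a]opprK mulNmx oppr_root // pos_root // pos_root_sigma.
Qed.

Lemma weyl_sigma u : weyl D u -> weyl D (sigma *m u *m invmx sigma).
Proof.
elim/weyl_ind => [|a {}u aP _ IHu].
  by rewrite mulmx1 mulmxV ?sigma_unit //; exact: weyl1.
have -> : sigma *m (refl a *m u) *m invmx sigma =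
    refl (char_act sigma a) *m (sigma *m u *m invmx sigma).
  rewrite sigma_coroot // /refl_mx /char_act mulmxBl mul1mx mulmxBl mul1mx.
  by rewrite mulmxBr mulmxBl !mulmxA mulmxKV ?sigma_unit.
exact: weylM (weyl_refl (sigma_Phi aP)) IHu.
Qed.

Lemma coroot_cone_sigma v : coroot_cone v -> coroot_cone (qmx sigma *m v).
Proof.
move=> [c c0 ->]; rewrite mulmx_sumr; apply: coroot_cone_sum => a ap.
rewrite -scalemxAr -toQ_mul -sigma_coroot ?pos_root //.
exact/coroot_coneZ/coroot_cone_pos/pos_root_sigmaV.
Qed.
Local Open Scope classical_set_scope.

(** * The base alcove and its stability under [Omega] and Frobenius *)

Definition in_alcove v := forall a, a \in pos -> 0 < pairingQ a v < 1.

Lemma pos_pairing_simple v : (forall d, d \in Delta -> 0 < pairingQ d v) ->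
  regular_dominant v.
Proof.
move=> vD a /pos_rootP[aP [m aE]].
have v0 d : d \in Delta -> 0 <= pairingQ d v *+ m d.
  by move=> dD; rewrite mulrn_wge0 // ltW // vD.
rewrite lt_neqAle aE pairingQ_comb big_seq sumr_ge0 // andbT eq_sym.
rewrite psumr_neq0 //; apply/negPn/negP => /hasPn h.
have := root_neq0 aP; rewrite aE big_seq big1 ?eqxx // => d dD.
have := h _ dD; rewrite dD /= pmulrn_rgt0 ?vD // lt0n negbK => /eqP ->.
by rewrite mulr0n.
Qed.

Lemma exists_in_alcove : exists v, in_alcove v.
Proof.
have [rho rhoE] := simple_coweight.
have rho0 : regular_dominant rho by apply: pos_pairing_simple => d /rhoE ->.
(* [M] exceeds the height of every positive root, so dividing [rho] by it brings all pairings below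
   1. *)
pose M := 1 + \sum_(a <- pos) pairingQ a rho.
have S0 (s : seq 'rV[int]_n) : {subset s <= pos} -> 0 <= \sum_(a <- s) pairingQ a rho.
  by move=> sP; rewrite big_seq sumr_ge0 // => a /sP/rho0/ltW.
have M0 : 0 < M by rewrite ltr_wpDr // S0.
exists (M^-1 *: rho) => a ap; rewrite pairingQZr mulr_gt0 ?invr_gt0 ?rho0 //=.
rewrite mulrC ltr_pdivrMr // mul1r /M (bigD1_seq a) ?fset_uniq //=.
rewrite addrCA ltrDl ltr_wpDr // -big_filter S0 // => b.
by rewrite mem_filter => /andP[].
Qed.

Definition iw_actQ (w : iw n) v : 'cV[rat]_n := qmx (lin w) *m v + toQ (trans w).

Lemma pairingQ_iw_actQ a w v :
  pairingQ a (iw_actQ w v) = pairingQ (a *m lin w) v + (pairing a (trans w))%:~R.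
Proof. by rewrite pairingQDr -pairingQ_mul pairingQ_toQ. Qed.

Local Notation tilde_const a := (if a \in pos then 1 else 0 : int).

(** Some [b] satisfies [tilde_root a (w x) = tilde_root b x] for all [x]; compare constant terms,
    then linear parts. *)
Lemma Omega_PiSet w a : Omega D w -> PiSet D a ->
  exists2 b, PiSet D b & a *m lin w = b /\
    tilde_const a - pairing a (trans w) = tilde_const b.
Proof.
move=> [wW wO] aPi; have wu := weyl_unit wW.
have : (tilde_root D @` PiSet D) (tilde_root D a) by exists a.
rewrite -wO => -[_ [b bPi <-] E]; exists b => //.
have {}E x : - pairing (a *m lin w) x + (tilde_const a - pairing a (trans w))
    = - pairing b x + tilde_const b.
  have := congr1 (fun h => h (iw_act w x)) E.
  rewrite /tilde_root /affine_root /= /iw_act /= mulmxDr mulKmx // addrK => ->.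
  by rewrite pairingDr opprD pairing_mul -addrA [_ - pairing a (trans w)]addrC.
have E0 : tilde_const a - pairing a (trans w) = tilde_const b.
  by have := E 0; rewrite /pairing !mulmx0 mxE oppr0 !add0r.
split=> //; apply: pairing_ext => x.
by have := E x; rewrite E0 => /addIr/oppr_inj.
Qed.

Lemma root_oppr_simple d : d \in Delta -> (- d \in pos) = false.
Proof. by move=> dD; apply/negbTE/pos_rootN/simple_pos. Qed.

(* If there is no highest root, [PiSet] only contains linear functions and [w]
   permutes the simple roots. *)
Lemma in_alcove_Omega w v : Omega D w -> in_alcove v -> in_alcove (iw_actQ w v).
Proof.
move=> wO va; have wW := wO.1.
have [[h hh]|noH] := pselect (exists h, highest_root D h).
  (* The alcove is where the affine roots of [PiSet] are positive: the simple roots bound all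
     positive roots from below, and [h] bounds them from above. [Omega_PiSet] carries this
     positivity from [v] to its image. *)
  have pi_gt0 b : PiSet D b -> 0 < (tilde_const b)%:~R - pairingQ b v.
    case=> [[d /= dD <-]|[bp _]].
      rewrite root_oppr_simple // pairingQNl opprK add0r.
      by case/andP: (va _ (simple_pos dD)).
    by rewrite bp subr_gt0; case/andP: (va _ bp).
  have pi_gt0' b : PiSet D b -> 0 < (tilde_const b)%:~R - pairingQ b (iw_actQ w v).
    move=> bPi; have [c cPi [bw bk]] := Omega_PiSet wO bPi.
    rewrite pairingQ_iw_actQ bw opprD addrCA -intrB bk addrC.
    exact: pi_gt0.
  have d0 d : d \in Delta -> 0 < pairingQ d (iw_actQ w v).
    move=> dD; have := pi_gt0' (- d); rewrite root_oppr_simple // pairingQNl opprK add0r.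
    by apply; left; exists d.
  move=> a ap; rewrite (pos_pairing_simple d0) //=.
  have : pairingQ h (iw_actQ w v) < 1.
    by have := pi_gt0' h (or_intror hh); rewrite hh.1 subr_gt0.
  apply: le_lt_trans; rewrite -subr_ge0 -pairingQNl -pairingQDl.
  have [m ->] := hh.2 a (pos_root ap); rewrite pairingQ_comb big_seq.
  by apply: sumr_ge0 => d dD; rewrite mulrn_wge0 // ltW // d0.
have simple_w d : d \in Delta -> d *m lin w \in Delta /\ pairing d (trans w) = 0.
  move=> dD; have dPi : PiSet D (- d) by left; exists d.
  have [b [[c /= cD <-]|hb] [bw]] := Omega_PiSet wO dPi; last by case: noH; exists b.
  rewrite !root_oppr_simple // sub0r pairingNl opprK => ->.
  by move/eqP: bw; rewrite mulNmx eqr_opp => /eqP ->.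
move=> a ap; rewrite pairingQ_iw_actQ.
suff [awp ->] : a *m lin w \in pos /\ pairing a (trans w) = 0 by rewrite addr0 va.
have [aP aC] := pos_rootP _ ap; split.
  apply/pos_rootP; split; first exact: weyl_root.
  by apply: nonneg_comb_mul aC => d /simple_w[dD _]; exact: nonneg_comb_simple.
case: aC => m ->; rewrite pairing_sum big_seq big1 // => d /simple_w[_ dt].
by rewrite pmulrn pairingMz dt mulr0.
Qed.

Lemma in_alcove_sigma v : in_alcove v -> in_alcove (qmx sigma *m v).
Proof. by move=> va a ap; rewrite -pairingQ_mul va // pos_root_sigma. Qed.

(** * [epsilon] as the chamber of lam - v *)

Implicit Types lam x : 'cV[int]_n.

(** An integer is compared with the value of [a] at [v], which lies in (0, 1) for positive [a] and
    in (-1, 0) for negative [a]; this accounts for the shift by 1. *)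
Lemma shifted_pairing_ge0 v lam a : in_alcove v -> a \in Phi ->
  (0 <= shifted_pairing D lam a) = (0 < pairingQ a (toQ lam - v)).
Proof.
move=> va aP; rewrite pairingQDr pairingQNr pairingQ_toQ subr_gt0 /shifted_pairing.
case: ifPn => ap; apply/idP/idP => h.
- have /andP[_ v1] := va _ ap; apply: lt_le_trans v1 _.
  by rewrite -[1]/(1%:~R) ler_int; lia.
- have /andP[v0 _] := va _ ap; have := lt_trans v0 h; rewrite -[0]/(0%:~R) ltr_int.
  lia.
- have [|/va] := root_pos_or_neg aP; first by rewrite (negPf ap).
  rewrite pairingQNl oppr_gt0 => /andP[v0 _]; apply: lt_le_trans v0 _.
  by rewrite ler0z.
- have [|/va] := root_pos_or_neg aP; first by rewrite (negPf ap).
  rewrite pairingQNl => /andP[_ v1]; have : - (1 : rat) < (pairing a lam)%:~R by lra.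
  by rewrite -[- 1]/((-1)%:~R) ltr_int; lia.
Qed.

(** The left side does not mention [v], so the alcove point on the right can be chosen to suit
    [lam]. *)
Lemma is_epsilonP v lam u : in_alcove v -> is_epsilon D lam u <->
  weyl D u /\ regular_dominant (qmx (invmx u) *m (toQ lam - v)).
Proof.
move=> va; split=> -[uW H]; split=> //.
  move=> a ap; rewrite -pairingQ_mul -(shifted_pairing_ge0 lam va); last first.
    by rewrite weyl_root ?pos_root //; exact: weylV.
  have : (char_act u @` [set` pos]) (char_act u a) by exists a.
  by rewrite -H => -[].
have uu := weyl_unit uW; apply/seteqP; split=> [a [aP la]|_ [a /= ap <-]].
  exists (a *m u); last by rewrite /char_act mulmxK.
  apply: (regular_dominant_pos H); first exact: weyl_root.
  by rewrite -pairingQ_mul mulmxK // -(shifted_pairing_ge0 lam va).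
have aP : char_act u a \in Phi by apply: weyl_root (weylV uW) (pos_root ap).
by split=> //; rewrite (shifted_pairing_ge0 lam va) // pairingQ_mul H.
Qed.

Lemma alcove_regular v lam a : in_alcove v -> a \in Phi ->
  pairingQ a (toQ lam - v) != 0.
Proof.
move=> va aP; rewrite pairingQDr pairingQNr pairingQ_toQ subr_eq0.
wlog ap : a aP / a \in pos.
  move=> hw; have [/hw|ap] := root_pos_or_neg aP; first exact.
  have := hw _ (oppr_root aP) ap.
  by rewrite pairingNl pairingQNl rmorphN eqr_opp.
have /andP[v0 v1] := va _ ap; apply/eqP => E; move: v0 v1; rewrite -E.
by rewrite -[0]/(0%:~R) -[1]/(1%:~R) !ltr_int; lia.
Qed.

Lemma epsilonP lam : is_epsilon D lam (epsilon D lam).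
Proof.
have [v va] := exists_in_alcove.
have [u uW [ud _]] := weyl_chamber (fun a aP => alcove_regular lam va aP).
apply: (@xgetPex _ _ (is_epsilon D lam)); exists (invmx u); apply/(is_epsilonP _ _ va).
by split; [exact: weylV | rewrite invmxK].
Qed.

Lemma is_epsilon_uniq lam u u' : is_epsilon D lam u -> is_epsilon D lam u' -> u = u'.
Proof.
have [v va] := exists_in_alcove.
move=> /(is_epsilonP _ _ va)[uW ud] /(is_epsilonP _ _ va)[uW' ud'].
have [uu uu'] := (weyl_unit uW, weyl_unit uW').
have E : invmx u *m u' = 1%:M.
  apply: weyl_pos_stable => [|a ap]; first exact: weylM (weylV uW) uW'.
  apply: (regular_dominant_pos ud').
    by rewrite weyl_root ?pos_root //; exact: weylM (weylV uW) uW'.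
  by rewrite -pairingQ_mul mulmxA mulmxK // pairingQ_mul ud.
by rewrite -[RHS](mulKVmx uu) E mulmx1.
Qed.

Lemma toQ_iw_act w lam v :
  toQ (iw_act w lam) - iw_actQ w v = qmx (lin w) *m (toQ lam - v).
Proof.
by rewrite mulmxBr -toQ_mul /iw_act /iw_actQ toQD opprD
  addrACA subrr addr0.
Qed.

(** The characterization is tested at the image of [v] under [w], where the difference of the two
    points is [lin w] applied to lam - v. *)
Lemma epsilon_iw_act w lam : Omega D w ->
  epsilon D (iw_act w lam) = lin w *m epsilon D lam.
Proof.
move=> wO; have [v va] := exists_in_alcove.
apply: (is_epsilon_uniq (epsilonP _)).
have [eW ed] := (is_epsilonP _ _ va).1 (epsilonP lam).
have [wu eu] := (weyl_unit wO.1, weyl_unit eW).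
apply/(is_epsilonP _ _ (in_alcove_Omega wO va)); split; first exact: weylM wO.1 eW.
rewrite toQ_iw_act mulmxA -map_mxM.
rewrite (_ : invmx _ = invmx (epsilon D lam) *m invmx (lin w)) ?mulmxKV //.
by apply: invmx_eq; rewrite mulmxA mulmxK // mulmxV.
Qed.

(** * Invariance of [flat] *)

(** Elements of [OmegaJ D b] commute with the affine map b sigma; [linE] and [transE] are the two
    components of b sigma(w) = w b. *)
Lemma natural_iw_act (b w : iw n) lam : Omega D b -> OmegaJ D b w ->
  natural D b (iw_act w lam) = lin w *m natural D b lam.
Proof.
move=> bO [wO wJ]; have bu := weyl_unit bO.1.
have linE : lin b *m (sigma *m lin w *m invmx sigma) = lin w *m lin b.
  have := congr1 (@lin n) wJ; rewrite /= => {2}<-.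
  by rewrite mulmxKV.
have transE : trans b + lin b *m (sigma *m trans w) = lin w *m trans b + trans w.
  have := congr1 (@trans n) wJ; rewrite /= => {2}<-.
  by rewrite linE mulmxN -(mulmxA (lin w)) mulKVmx // addrCA subrr addr0.
have lamE : lin b *m (sigma *m (lin w *m lam)) = lin w *m (lin b *m (sigma *m lam)).
  by rewrite !mulmxA -linE !mulmxA mulmxKV ?sigma_unit.
rewrite /natural /iw_act !mulmxDr mulmxN lamE.
have -> : lin w *m trans b = trans b + lin b *m (sigma *m trans w) - trans w.
  by rewrite transE addrK.
by rewrite opprD !addrA addrAC; congr (_ - _ - _); apply: addrAC.
Qed.

Lemma flat_iw_act (b w : iw n) lam : Omega D b -> OmegaJ D b w ->
  flat D b (iw_act w lam) = flat D b lam.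
Proof.
move=> bO wJ; have wO := wJ.1; have [eW _] := epsilonP lam.
have [wu eu] := (weyl_unit wO.1, weyl_unit eW).
rewrite /flat natural_iw_act // epsilon_iw_act // mulmxA.
rewrite (_ : invmx _ = invmx (epsilon D lam) *m invmx (lin w)) ?mulmxKV //.
by apply: invmx_eq; rewrite mulmxA mulmxK // mulmxV.
Qed.

(** * Central vectors and the Frobenius average *)

Lemma central_weyl u v : weyl D u -> (forall a, a \in Phi -> pairingQ a v = 0) ->
  qmx u *m v = v.
Proof.
move=> + v0; elim/weyl_ind => [|a {}u aP _ IHu]; first by rewrite map_mx1 mul1mx.
by rewrite map_mxM -mulmxA IHu qmx_refl v0 // scale0r subr0.
Qed.

Lemma diamondD v v' : diamond D (v + v') = diamond D v + diamond D v'.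
Proof.
rewrite /diamond -scalerDr -big_split; congr (_ *: _).
by apply: eq_bigr => i _; rewrite mulmxDr.
Qed.

Lemma diamondN v : diamond D (- v) = - diamond D v.
Proof.
rewrite /diamond -scalerN -sumrN; congr (_ *: _).
by apply: eq_bigr => i _; rewrite mulmxN.
Qed.

Lemma qmx_sigma_exp i v : qmx (sigma ^+ i) *m v = iter i (mulmx (qmx sigma)) v.
Proof.
elim: i => [|i /= <-]; first by rewrite expr0 map_mx1 mul1mx.
by rewrite mulmxA -map_mxM exprS.
Qed.

Lemma diamond_sigma v : diamond D (qmx sigma *m v) = diamond D v.
Proof.
rewrite /diamond; congr (_ *: _).
under eq_bigr do rewrite qmx_sigma_exp -iterSr.
under [RHS]eq_bigr do rewrite qmx_sigma_exp.
rewrite -(big_mkord xpredT (fun i => iter i.+1 (mulmx (qmx sigma)) v)).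
rewrite -(big_mkord xpredT (fun i => iter i (mulmx (qmx sigma)) v)).
apply/eqP; rewrite -subr_eq0 -sumrB telescope_sumr ?leq0n //.
by rewrite -qmx_sigma_exp sigma_sdeg map_mx1 mul1mx subrr.
Qed.

Lemma diamond_fixed v : qmx sigma *m v = v -> diamond D v = v.
Proof.
move=> sv; rewrite /diamond.
under eq_bigr do rewrite qmx_sigma_exp iter_fix //.
rewrite sumr_const card_ord -scaler_nat scalerA mulVf ?scale1r //.
by rewrite pnatr_eq0 -lt0n sdeg_gt0.
Qed.

Lemma coroot_cone_diamond v : coroot_cone v -> coroot_cone (diamond D v).
Proof.
move=> vC; apply: coroot_coneZ; first by rewrite invr_ge0 ler0n.
apply: coroot_cone_sum => i _; rewrite qmx_sigma_exp.
by elim: (nat_of_ord i) => //= k; exact: coroot_cone_sigma.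
Qed.

(** * The Newton point of an element of [Omega] *)

Section Newton.
Variable b : iw n.
Hypothesis bO : Omega D b.
Local Notation frob := (fun v => iw_actQ b (qmx sigma *m v)).

Lemma in_alcove_frob i v : in_alcove v -> in_alcove (iter i frob v).
Proof.
by move=> va; elim: i => //= i IHi; apply: in_alcove_Omega => //; exact: in_alcove_sigma.
Qed.

(** (b sigma)^m is [sigma_norm D b m] followed on the right by sigma^m. *)
Lemma sigma_norm_act m v :
  iw_actQ (sigma_norm D b m) (qmx (sigma ^+ m) *m v) = iter m frob v.
Proof.
elim: m => [|m IHm].
  by rewrite expr0 !map_mx1 /iw_actQ /= map_mx1 !mul1mx /toQ map_mx0 addr0.
rewrite /= -IHm exprS map_mxM -mulmxA; set w := sigma_norm D b m.
move: (qmx (sigma ^+ m) *m v) => {IHm}v.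
rewrite /iw_actQ /= toQD !toQ_mul [toQ (trans b) + _]addrC addrA !mulmxDr.
congr (_ + _ + _).
by rewrite !mulmxA -!map_mxM mulmxKV ?sigma_unit.
Qed.

Lemma sigma_norm_weyl m : weyl D (lin (sigma_norm D b m)).
Proof.
elim: m => [|m IHm] /=; first exact: weyl1.
exact: weylM bO.1 (weyl_sigma IHm).
Qed.

Lemma sigma_norm_lin m :
  lin (sigma_norm D b m) *m sigma ^+ m = (lin b *m sigma) ^+ m.
Proof.
elim: m => [|m IHm]; first by rewrite !expr0 mulmx1.
rewrite !exprS -IHm /=.
have -> : sigma * sigma ^+ m = sigma *m sigma ^+ m by [].
rewrite !mulmxA mulmxKV ?sigma_unit //.
by rewrite -[RHS]/(lin b *m sigma *m (lin (sigma_norm D b m) *m sigma ^+ m)) !mulmxA.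
Qed.

Lemma finite_order_roots u : u \in unitmx -> (forall a, a \in Phi -> a *m u \in Phi) ->
  exists2 N, (0 < N)%N & forall a, a \in Phi -> a *m u ^+ N = a.
Proof.
move=> uu uP; pose h (a : Phi) : Phi := [` uP _ (valP a)]%fset.
have h_inj : injective h.
  move=> a a' /(congr1 val) /= /(congr1 (mulmx^~ (invmx u))).
  by rewrite !mulmxK // => /val_inj.
exists #[perm h_inj]%g; first exact: order_gt0.
move=> a aP; have /permP/(_ [` aP]%fset) := expg_order (perm h_inj).
rewrite permX perm1 => /(congr1 val) /= {2}<-.
elim: #[_]%g => [|k IHk] /=; first by rewrite expr0 mulmx1.
rewrite exprSr; have -> : u ^+ k * u = u ^+ k *m u by [].
by rewrite mulmxA IHk permE.
Qed.

(** The linear part of b sigma permutes the finite set of roots, so a power with exponent [m]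
    divisible by [sdeg D] fixes all roots. As sigma^m = 1, that power is an element of W_0
    stabilizing the positive roots, hence trivial. *)
Lemma exists_sigma_norm_translation : exists m t,
  [/\ (0 < m)%N, sigma ^+ m = 1%:M & sigma_norm D b m = translation t].
Proof.
have bu := weyl_unit bO.1.
have gu : lin b *m sigma \in unitmx by rewrite unitmx_mul bu sigma_unit.
have [a aP|N N0 gN] := finite_order_roots gu.
  by rewrite mulmxA root_sigma // weyl_root //; case: bO.
pose m := (N * sdeg D)%N; have sm : sigma ^+ m = 1%:M.
  rewrite /m mulnC exprM sigma_sdeg; exact: expr1n.
have gm a : a \in Phi -> a *m (lin b *m sigma) ^+ m = a.
  move=> aP; rewrite /m exprM; elim: (sdeg D) => [|k IHk]; first by rewrite expr0 mulmx1.
  rewrite exprS.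
  have -> : (lin b *m sigma) ^+ N * (lin b *m sigma) ^+ N ^+ k =
    (lin b *m sigma) ^+ N *m (lin b *m sigma) ^+ N ^+ k by [].
  by rewrite mulmxA gN.
exists m, (trans (sigma_norm D b m)); split=> //; first by rewrite muln_gt0 N0 sdeg_gt0.
suff lin1 : lin (sigma_norm D b m) = 1%:M.
  by move: lin1; case: (sigma_norm D b m) => t l /= ->.
apply: weyl_pos_stable => [|a ap]; first exact: sigma_norm_weyl.
by move: (gm _ (pos_root ap)); rewrite -sigma_norm_lin sm mulmx1 => ->.
Qed.

Section Translation.
Variables (m : nat) (t : 'cV[int]_n).
Hypotheses (sm : sigma ^+ m = 1%:M) (bm : sigma_norm D b m = translation t).

Lemma iter_frob v : iter m frob v = v + toQ t.
Proof.
by rewrite -sigma_norm_act sm bm /iw_actQ /= !map_mx1 !mul1mx.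
Qed.

(** Translation by [t] is a power of b sigma and so preserves the alcove; an integer that keeps a
    value in (0, 1) within (-1, 1) of itself is 0. *)
Lemma pairing_sigma_norm a : a \in Phi -> pairing a t = 0.
Proof.
wlog ap : a / a \in pos.
  move=> hw aP; have [/hw|ap] := root_pos_or_neg aP; first exact.
  by have := hw _ ap (oppr_root aP); rewrite pairingNl => /eqP; rewrite oppr_eq0 => /eqP.
have [v va] := exists_in_alcove; have /andP[v0 v1] := va _ ap.
have := in_alcove_frob m va ap; rewrite iter_frob pairingQDr pairingQ_toQ.
move=> /andP[w0 w1] _.
have l : - (1 : rat) < (pairing a t)%:~R by lra.
have r : (pairing a t)%:~R < (1 : rat) by lra.
by move: l r; rewrite -[- 1]/((-1)%:~R) -[1]/(1%:~R) !ltr_int; lia.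
Qed.

Lemma sigma_sigma_norm : qmx sigma *m toQ t = toQ t.
Proof.
have t0 a : a \in Phi -> pairingQ a (qmx sigma *m toQ t) = 0.
  by move=> aP; rewrite -pairingQ_mul pairingQ_toQ pairing_sigma_norm // root_sigma.
rewrite -[LHS](central_weyl bO.1 t0).
(* b sigma commutes with its [m]-th power, translation by [t]; evaluating at 0 shows that its linear
   part fixes [t]. *)
have := iter_frob (frob 0); rewrite -iterSr iterS iter_frob /= /iw_actQ.
by rewrite !mulmxDr !mulmx0 !add0r [RHS]addrC => /addIr.
Qed.

Hypothesis m_gt0 : (0 < m)%N.

(** Average an orbit of b sigma over [m] steps: convexity keeps the average in the alcove, and the
    displacement telescopes to t / m. *)
Lemma exists_alcove_fixed_point :
  exists2 v, in_alcove v & frob v = v + m%:R^-1 *: toQ t.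
Proof.
have m0 : (m%:R : rat) != 0 by rewrite pnatr_eq0 -lt0n.
have [v0 va] := exists_in_alcove; pose x i := iter i frob v0.
have xa i : in_alcove (x i) by exact: in_alcove_frob.
pose v := m%:R^-1 *: \sum_(0 <= i < m) x i; exists v.
  move=> a ap; rewrite /v pairingQZr pairingQ_sumr mulrC.
  have has_m : has xpredT (index_iota 0 m) by rewrite has_predT size_iota subn0.
  rewrite divr_gt0 ?ltr0n //; last first.
    have : \sum_(0 <= i < m) (0 : rat) < \sum_(0 <= i < m) pairingQ a (x i).
      by apply: ltr_sum => // i _; case/andP: (xa i _ ap).
    by rewrite big1_eq.
  rewrite ltr_pdivrMr ?ltr0n // mul1r.
  have -> : m%:R = \sum_(0 <= i < m) (1 : rat) by rewrite sumr_const_nat subn0.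
  by apply: ltr_sum => // i _; case/andP: (xa i _ ap).
have -> : frob v = m%:R^-1 *: \sum_(0 <= i < m) x i.+1.
  rewrite /x /= /iw_actQ /v big_split /= sumr_const_nat subn0 scalerDr.
  rewrite -scaler_nat scalerA mulVf // scale1r -!mulmx_sumr.
  by rewrite -!scalemxAr.
apply/eqP; rewrite addrC -subr_eq -scalerBr -sumrB telescope_sumr //.
by rewrite /x iter_frob /= addrC addKr.
Qed.

End Translation.

Lemma newton_fixed_point : exists v, [/\ in_alcove v,
  frob v = v + newton D b, qmx sigma *m newton D b = newton D b &
  forall a, a \in Phi -> pairingQ a (newton D b) = 0].
Proof.
have [m [t [m0 sm bm]]] := exists_sigma_norm_translation.
(* [newton] is a choice, so a Newton point is exhibited first; afterwards only the data [m], [t],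
   [u] of the chosen one are used, and [u] fixes the central [t]. *)
have : is_newton_point D b (newton D b).
  apply: (@xgetPex _ _ (is_newton_point D b)); exists (m%:R^-1 *: toQ t); split.
    move=> a ap; change (0 <= pairingQ a (m%:R^-1 *: toQ t)).
    by rewrite pairingQZr pairingQ_toQ (pairing_sigma_norm sm bm) ?mulr0 ?pos_root.
  by exists m, t, 1%:M; split=> //; [exact: weyl1 | rewrite mul1mx].
move=> [_ {m0 sm bm}[{}m [{}t [u [m0 sm bm uW ->]]]]].
have t0 a : a \in Phi -> pairingQ a (toQ t) = 0.
  by move=> aP; rewrite pairingQ_toQ (pairing_sigma_norm sm bm).
rewrite toQ_mul central_weyl //.
have [v va vE] := exists_alcove_fixed_point sm bm m0; exists v; split=> //.
  by rewrite -scalemxAr (sigma_sigma_norm sm bm).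
by move=> a aP; rewrite pairingQZr t0 // mulr0.
Qed.

(** * The bound and the map on the quotient *)

Lemma flat_diamond_le lam : leQ D (diamond D (toQ (flat D b lam))) (newton D b).
Proof.
have [v [va vE sz z0]] := newton_fixed_point; set z := newton D b in vE sz z0 *.
have [eW yd] := (is_epsilonP _ _ va).1 (epsilonP lam).
rewrite /flat; set e := epsilon D lam in eW yd *; set y := qmx _ *m _ in yd.
have eu := weyl_unit eW; have qe : qmx e *m qmx (invmx e) = 1%:M.
  by rewrite -map_mxM mulmxV // map_mx1.
have xE : toQ lam - v = qmx e *m y by rewrite mulmxA qe mul1mx.
clearbody y.
have natE : toQ (natural D b lam) =
    qmx (lin b *m sigma) *m (qmx e *m y) - qmx e *m y + z.
  have -> : toQ (natural D b lam) = frob (toQ lam) - toQ lam.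
    by rewrite /natural toQB /iw_actQ -!toQ_mul -toQD.
  have -> : frob (toQ lam) = qmx (lin b *m sigma) *m (toQ lam - v) + frob v.
    by rewrite /iw_actQ map_mxM mulmxBr !mulmxA addrA subrK.
  by rewrite vE -xE opprB -!addrA; congr (_ + (_ + _)); apply: addrC.
(* Moving [sigma] past [e] makes the linear part an element of W_0 acting on sigma y, which gives
   flat = w sigma y - y + z. *)
pose w := invmx e *m lin b *m (sigma *m e *m invmx sigma).
have wW : weyl D w.
  exact: weylM (weylM (weylV eW) bO.1) (weyl_sigma eW).
have flatE : toQ (invmx e *m natural D b lam) =
    (qmx sigma *m y - y) + z - (qmx sigma *m y - qmx w *m (qmx sigma *m y)).
  have -> : qmx w *m (qmx sigma *m y) = qmx (invmx e *m lin b *m sigma *m e) *m y.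
    by rewrite mulmxA -map_mxM /w !mulmxA mulmxKV ?sigma_unit.
  rewrite toQ_mul natE !mulmxDr mulmxN (central_weyl (weylV eW) z0).
  have -> : qmx (invmx e) *m (qmx e *m y) = y.
    by rewrite mulmxA -map_mxM mulVmx // map_mx1 mul1mx.
  rewrite !mulmxA -!map_mxM !mulmxA.
  by rewrite opprB [RHS]addrC -!addrA addKr.
change (coroot_cone (z - diamond D (toQ (invmx e *m natural D b lam)))).
rewrite flatE !(diamondD, diamondN) diamond_sigma (diamond_fixed sz) subrr add0r.
rewrite opprD addrA subrr sub0r opprK -{1}[diamond D y]diamond_sigma -diamondN -diamondD.
(* What remains is the average of sigma y - w sigma y, with sigma y regular dominant. *)
apply/coroot_cone_diamond/weyl_regular_dominant_max => // a ap.
by rewrite -pairingQ_mul yd // pos_root_sigma.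
Qed.

End Newton.

Lemma OmegaJ1 (b : iw n) : Omega D b -> OmegaJ D b (translation 0).
Proof.
move=> bO; have bu := weyl_unit bO.1; split; first split; first exact: weyl1.
  have -> : iw_act (iw_inv (translation 0)) = id :> ('cV[int]_n -> _).
    apply/funext => x; rewrite /iw_act /= (invmx_eq (mulmx1 _)) mul1mx.
    by rewrite mulmx0 oppr0 addr0.
  by apply/seteqP; split=> [_ [f fP <-]|f fP] //; exists f.
rewrite /iw_mul /iw_sigma /iw_inv /translation /=; congr IW.
  rewrite !mulmx0 addr0 mulmx1 mulmxV ?sigma_unit // mulmx1.
  by rewrite mulmxN mulKVmx // subrr.
by rewrite mulmx1 mulmxV ?sigma_unit // mulmx1 mulmxV.
Qed.

Lemma iw_act1 lam : iw_act (translation 0) lam = lam.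
Proof. by rewrite /iw_act mul1mx addr0. Qed.

Lemma weyl_orbit_weyl mu x u : weyl D u ->
  weyl_orbit D mu x -> weyl_orbit D mu (u *m x).
Proof.
by move=> uW [w wW <-]; exists (u *m w); [exact: weylM | rewrite mulmxA].
Qed.

End Roots.

Theorem proposition3p9 (n : nat) (D : based_root_datum n)
    (mu : 'cV[int]_n) (b : iw n)
    (irr : irreducible_root_system D)
    (mu_dom : dominant D mu) (mu_min : minuscule D mu)
    (b_Omega : Omega D b) (b_mu : in_BGmu D mu b) :
  (forall w lam, OmegaJ D b w -> Amub D mu b lam -> Amub D mu b (iw_act w lam)) /\
  exists f : set 'cV[int]_n -> 'cV[int]_n,
    set_fun (OmegaJ_quot_Amub D mu b) (flat_target D mu b) f /\
    forall lam, Amub D mu b lam -> f (OmegaJ_orbit D b lam) = flat D b lam.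
Proof.
split=> [w lam wJ lamA|].
  by rewrite /Amub /= natural_iw_act //; apply: weyl_orbit_weyl wJ.1.1 _.
(* Evaluate [flat] at a chosen representative in [Amub]; the default 0 is reached only off the
   quotient. *)
pose f S := flat D b (xget 0 [set lam | Amub D mu b lam /\ OmegaJ_orbit D b lam = S]).
have fE lam : Amub D mu b lam -> f (OmegaJ_orbit D b lam) = flat D b lam.
  move=> lamA; rewrite /f; case: xgetP => [lam' _ [_ orbE]|/(_ lam)[] //].
  (* The chosen [lam'] lies in its own orbit, which is that of [lam], so it is a translate of [lam]
     by some [w]. *)
  have : OmegaJ_orbit D b lam' lam'.
    by exists (translation 0); [exact: OmegaJ1 | exact: iw_act1].
  by rewrite orbE => -[w wJ <-]; apply: flat_iw_act.
exists f; split=> // _ [lam lamA <-]; rewrite fE //; split.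
  by apply: weyl_orbit_weyl lamA; apply: weylV (epsilonP D lam).1.
exact: flat_diamond_le.
Qed.
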